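(* Let $f\in\mathbb{R}[x_1,\dots,x_m]$ be stable and complex determinantal, i.e. $$f=\det\Big(\mathrm{diag}(x_1,\dots,x_n)+\sum_{j=n+1}^m A_jx_j+A_0\Big)$$ for some $n\times n$ complex matrices $A_0,A_{n+1},\dots,A_m$ (with $n\le m$). Then there exist $n\times n$ Hermitian matrices $B_0,B_{n+1},\dots,B_m$ for which $$f=\det\Big(\mathrm{diag}(x_1,\dots,x_n)+\sum_{j=n+1}^m B_jx_j+B_0\Big).$$
   Context: A polynomial $f\in\mathbb{R}[x_1,\dots,x_m]$ is (real) stable if $f(z_1,\dots,z_m)\neq 0$ whenever $z_1,\dots,z_m\in\mathbb{C}$ all have strictly positive imaginary part. *)

(* Defs.v *)
From mathcomp Require Import all_boot all_order all_algebra.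
From mathcomp Require Import reals complex mpoly.

Set Implicit Arguments.
Unset Strict Implicit.
Unset Printing Implicit Defensive.

Import Order.TTheory GRing.Theory Num.Theory.
Local Open Scope ring_scope.
Local Open Scope complex_scope.

Definition complexify (R : realType) (m : nat) (f : {mpoly R[m]}) :
    {mpoly R[i][m]} :=
  map_mpoly (real_complex R) f.

Definition stable (R : realType) (m : nat) (f : {mpoly R[m]}) : Prop :=
  forall z : 'I_m -> R[i],
    (forall k, 0 < complex.Im (z k)) -> (complexify f).@[z] != 0.

(* diag(x_1, .., x_n) + \sum_(n < j <= m) x_j A_j + A_0.  Variables are
   numbered from 0, so x_1, .., x_n are the 'X_k with k < n and the sum ranges
   over n <= j < m; the values A j for j < n are never used. *)
Definition pencil (R : realType) (n m : nat) (le_nm : (n <= m)%N)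
    (A0 : 'M[R[i]]_n) (A : 'I_m -> 'M[R[i]]_n) : 'M[{mpoly R[i][m]}]_n :=
  diag_mx (\row_(k < n) 'X_(widen_ord le_nm k))
  + \sum_(j < m | (n <= j)%N) 'X_j *: map_mx (@mpolyC m _) (A j)
  + map_mx (@mpolyC m _) A0.

Definition complex_determinantal (R : realType) (n m : nat)
    (le_nm : (n <= m)%N) (f : {mpoly R[m]}) : Prop :=
  exists (A0 : 'M[R[i]]_n) (A : 'I_m -> 'M[R[i]]_n),
    complexify f = \det (pencil le_nm A0 A).

(* Main.v *)
Require Import Defs.
From mathcomp Require Import all_boot all_order all_algebra.
From mathcomp Require Import reals complex mpoly ring polyrcf.

(** Write M(x, z) = diag(x) + L(z), with L(z) = A_0 + \sum_j z_j A_j affine in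
    the remaining variables. The Hermitian matrices are obtained entrywise,
    without choosing any change of basis: in each A_j the two opposite entries
    a and b at (i, k) and (k, i) are rescaled by reciprocal positive factors
    so as to have the same modulus ([balance]). Two things need proof, and
    both rest on a positivity property.

    Positivity. Fix a real z and put F(x) = det M(x, z). Then F is real on real
    points and, for i != j, its Rayleigh difference
      F(x + e_i) F(x + e_j) - F(x) F(x + e_i + e_j)
    is nonnegative there ([stable_rayleigh]): were it negative, the equation
    F = 0 would express x_j as a Moebius transform of x_i preserving the upper
    half plane, and a small perturbation of the other variables into the upper
    half plane would yield a zero forbidden by stability. The property
    [rayleigh] passes to principal submatrices, by looking at leading
    coefficients, hence L_ij L_ji >= 0 ([rayleigh_entry]). It also passes to
    rank one corrections L' + t u v with t real and nonzero, where L is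
    (p v; u L') in blocks: up to the remaining diagonal variables, such a matrix
    is a Schur complement of diag(x) + L for a suitable real value of the first
    variable ([rayleigh_schur]).

    Balancing is affine. If (a + t c)(b + t d) >= 0 for all real t, the
    discriminant of this quadratic in t forces |b| / |a| = |d| / |c|, so all
    the pairs (a + t c, b + t d) are rescaled by the same factor
    ([balance_affine], [balance_sum]). Therefore balancing the A_j amounts to
    balancing the value L(z) at each real z ([pencil_const_balance]).

    Balancing preserves the determinant ([rayleigh_balance]). By induction on
    the size: a Schur complement of the balanced matrix is the balanced Schur
    complement L' + t u v, because balancing is affine in the real parameter t
    and multiplicative on the entries of u v. When entries (i, j), (i, 0) and
    (0, j) are nonzero this says that the rescaling factor of the first is the
    product of the other two, which is what makes the products of entries along
    a cycle agree.

    Finally, two polynomials that agree at all points with natural coordinates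
    are equal ([mpoly_nat_eq0]). *)

Set Implicit Arguments.
Unset Strict Implicit.
Unset Printing Implicit Defensive.

Import Order.TTheory GRing.Theory Num.Theory.
Local Open Scope ring_scope.

(** * Balancing a pair of opposite entries *)

(** Nonnegative elements of C are real, so comparing the values at t and - t
    shows that the three coefficients are real; the rest is the usual study of
    the discriminant. *)
Lemma real_quadratic_ge0 (C : numClosedFieldType) (a b c : C) :
    (forall t, t \is Num.real -> 0 <= a + t * b + t ^+ 2 * c) ->
  [/\ 0 <= a, 0 <= c, b \is Num.real & b ^+ 2 <= 4 * (a * c)].
Proof.
move=> quad_ge0.
have a_ge0 : 0 <= a.
  by have := quad_ge0 0 (rpred0 _); rewrite expr0n !mul0r !addr0.
have even_ge0 t : t \is Num.real -> 0 <= a + t ^+ 2 * c.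
  move=> t_real; rewrite -(pmulrn_lge0 _ (ltn0Sn 1)).
  suff -> : (a + t ^+ 2 * c) *+ 2
      = (a + t * b + t ^+ 2 * c) + (a + (- t) * b + (- t) ^+ 2 * c).
    by apply: addr_ge0; apply: quad_ge0; rewrite ?rpredN.
  by ring.
have c_real : c \is Num.real.
  have -> : c = (a + 1 ^+ 2 * c) - a by ring.
  by rewrite rpredB ?ger0_real // even_ge0 ?rpred1.
have b_real : b \is Num.real.
  have -> : b = (a + 1 * b + 1 ^+ 2 * c) - (a + 1 ^+ 2 * c) by ring.
  by rewrite rpredB ?ger0_real ?even_ge0 ?quad_ge0 ?rpred1.
have c_ge0 : 0 <= c.
  have [//|c_lt0] := real_ge0P c_real.
  have a1c_ge0 : 0 <= (a + 1) / - c.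
    by rewrite divr_ge0 ?addr_ge0 ?ler01 // oppr_ge0 ltW.
  (* If c < 0, take t with t^2 = (a + 1) / - c, which gives a + t^2 c = -1. *)
  have := even_ge0 (sqrtC ((a + 1) / - c)).
  rewrite ger0_real ?sqrtC_ge0 // sqrtCK => /(_ isT).
  have -> : a + (a + 1) / - c * c = -1 by field; rewrite lt_eqF.
  by rewrite ler0N1.
split=> //; have [c0|c_neq0] := eqVneq c 0.
  have [->|b_neq0] := eqVneq b 0; first by rewrite c0 expr0n !mulr0.
  (* If c = 0 and b != 0, the linear function takes the value -1. *)
  have := quad_ge0 (- (a + 1) / b).
  rewrite rpredM ?rpredV ?b_real ?rpredN ?rpredD ?rpred1 ?(ger0_real a_ge0) //.
  move=> /(_ isT).
  rewrite c0 mulr0 addr0 divfK //.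
  have -> : a - (a + 1) = -1 by ring.
  by rewrite ler0N1.
(* The minimum of the quadratic. *)
have := quad_ge0 (- b / (2 * c)).
rewrite !(rpredM, rpredV, rpredN) ?b_real ?(ger0_real c_ge0) ?realn //.
move=> /(_ isT).
have -> : a + - b / (2 * c) * b + (- b / (2 * c)) ^+ 2 * c
    = (4 * (a * c) - b ^+ 2) / (4 * c).
  by field; rewrite c_neq0.
by rewrite pmulr_lge0 ?subr_ge0 // invr_gt0 mulr_gt0 // lt_def c_neq0.
Qed.

Section Balance.
Variable C : numClosedFieldType.
Implicit Types a b c d t : C.

(** This has the argument of a, and for modulus the geometric mean of |a| and
    |b|. As division by zero gives zero, the result is 0 as soon as a or b
    is. *)
Definition balance a b := sqrtC (`|b| / `|a|) * a.

Lemma balance0l b : balance 0 b = 0.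
Proof. by rewrite /balance mulr0. Qed.

Lemma balance_id a : balance a a = a.
Proof.
have [->|a_neq0] := eqVneq a 0; first exact: balance0l.
by rewrite /balance divff ?normr_eq0 // sqrtC1 mul1r.
Qed.

(** Zero entries are covered because inversion maps zero to zero; this spares
    the Schur complement argument any case distinction. *)
Lemma balanceM a b c d :
  balance (a * c) (b * d) = balance a b * balance c d.
Proof.
rewrite /balance !normrM invfM mulrACA rootCMl ?divr_ge0 //.
by rewrite mulrACA.
Qed.

Lemma ge0_mul_conj a b : 0 <= a * b -> a != 0 -> b = `|b| / `|a| * a^*.
Proof.
move=> ab_ge0 a_neq0; apply: (mulfI a_neq0).
by rewrite mulrCA -normCK expr2 mulrA divfK ?normr_eq0 // mulrC -normrM
  mulrC ger0_norm.
Qed.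

(** Since a b >= 0, the numbers a and b^* have the same argument; this is why
    equalizing the moduli of opposite entries makes them conjugate. *)
Lemma balance_conj a b : 0 <= a * b -> balance b a = (balance a b)^*.
Proof.
move=> ab_ge0.
have [->|a_neq0] := eqVneq a 0.
  by rewrite /balance normr0 mul0r sqrtC0 mul0r mulr0 conjC0.
have [->|b_neq0] := eqVneq b 0.
  by rewrite /balance normr0 mul0r sqrtC0 mul0r mulr0 conjC0.
set k := `|b| / `|a|.
have k_ge0 : 0 <= k by rewrite divr_ge0.
have k_neq0 : k != 0 by rewrite mulf_neq0 ?invr_eq0 ?normr_eq0.
rewrite /balance -/k rmorphM /= (CrealP _) ?ger0_real ?sqrtC_ge0 //.
rewrite -[`|a| / _]invf_div -/k rootCV // [X in _ * X](ge0_mul_conj ab_ge0) //.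
by rewrite -/k mulrA -{2}[k]sqrtCK expr2 mulKf // sqrtC_eq0.
Qed.

(** Expand (a + t c)(b + t d) = ab + t (ad + cb) + t^2 cd. The product of ad and
    cb is ab cd >= 0, their sum is real, and the discriminant says that the
    square of their difference is nonpositive, so ad and cb are conjugate. In
    particular |ad| = |cb|: one factor rescales both (a, b) and (c, d). *)
Lemma balance_affine a b c d :
    (forall t, t \is Num.real -> 0 <= (a + t * c) * (b + t * d)) ->
  forall t, t \is Num.real ->
  balance (a + t * c) (b + t * d) = balance a b + t * balance c d.
Proof.
move=> pos t t_real.
have [|ab_ge0 cd_ge0 s_real disc] :=
    @real_quadratic_ge0 C (a * b) (a * d + c * b) (c * d).
  move=> u u_real; have := pos u u_real.
  by congr (0 <= _); ring.
have diff_sqr : (a * d - c * b) ^+ 2 <= 0.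
  have -> : (a * d - c * b) ^+ 2
      = (a * d + c * b) ^+ 2 - 4 * (a * b * (c * d)) by ring.
  by rewrite subr_le0.
(* A number of nonpositive square is purely imaginary. *)
have diff_conj : (a * d - c * b)^* = - (a * d - c * b).
  have rot_sqr : 0 <= ((a * d - c * b) * 'i) ^+ 2.
    by rewrite exprMn sqrCi mulrN1 oppr_ge0.
  have rot_real : (a * d - c * b) * 'i \is Num.real.
    have := rot_sqr; rewrite -sqrtC_ge0 => /ger0_real root_real.
    have /eqP := sqrtCK (((a * d - c * b) * 'i) ^+ 2).
    rewrite eqf_sqr => /orP[] /eqP root_eq; first by rewrite -root_eq.
    by rewrite -[_ * _]opprK rpredN -root_eq.
  move/CrealP: rot_real; rewrite rmorphM /= conjCi mulrN -mulNr.
  by move/(mulIf (neq0Ci _))=> conj_eq; rewrite -{2}conj_eq opprK.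
have norm_eq : `|a * d| = `|c * b|.
  suff -> : c * b = (a * d)^* by rewrite norm_conjC.
  have -> : (a * d)^* = ((a * d + c * b)^* + (a * d - c * b)^*) / 2.
    by rewrite -rmorphD /= addrACA subrr addr0 rmorphD /=; field.
  by rewrite diff_conj (CrealP s_real); field.
have [a0|a_neq0] := eqVneq a 0.
  move: norm_eq; rewrite a0 mul0r normr0 => /esym/eqP.
  rewrite normr_eq0 mulf_eq0 balance0l !add0r => /orP[] /eqP ->.
    by rewrite !mulr0 !balance0l mulr0.
  by rewrite add0r balanceM balance_id.
have [c0|c_neq0] := eqVneq c 0.
  move: norm_eq; rewrite c0 mul0r normr0 => /eqP.
  rewrite normr_eq0 mulf_eq0 (negPf a_neq0) /= => /eqP ->.
  by rewrite !mulr0 balance0l mulr0 !addr0.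
have ratio_eq : `|b| / `|a| = `|d| / `|c|.
  apply/eqP; rewrite eqr_div ?normr_eq0 // -!normrM eq_sym [d * a]mulrC.
  by rewrite norm_eq mulrC.
have [ac0|ac_neq0] := eqVneq (a + t * c) 0.
  by rewrite ac0 balance0l /balance -ratio_eq mulrCA -mulrDr ac0 mulr0.
have -> : b + t * d = `|b| / `|a| * (a + t * c)^*.
  rewrite {1}(ge0_mul_conj ab_ge0 a_neq0) {1}(ge0_mul_conj cd_ge0 c_neq0).
  by rewrite -ratio_eq rmorphD rmorphM /= (CrealP t_real) mulrDr [t * _]mulrCA.
rewrite /balance -ratio_eq normrM norm_conjC mulfK ?normr_eq0 //.
by rewrite ger0_norm ?divr_ge0 // mulrDr [t * (_ * _)]mulrCA.
Qed.

(** The case of several real parameters, one parameter at a time: [a] and [b]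
    absorb the terms already treated. *)
Lemma balance_sum (I : eqType) (r : seq I) a b (p q x : I -> C) :
    uniq r ->
    (forall y : I -> C, (forall j, y j \is Num.real) ->
      0 <= (a + \sum_(j <- r) y j * p j) * (b + \sum_(j <- r) y j * q j)) ->
    (forall j, x j \is Num.real) ->
  balance (a + \sum_(j <- r) x j * p j) (b + \sum_(j <- r) x j * q j)
  = balance a b + \sum_(j <- r) x j * balance (p j) (q j).
Proof.
move=> r_uniq pos x_real.
elim: r a b r_uniq pos => [|k r IHr] a b.
  by rewrite !big_nil !addr0.
rewrite /= => /andP[k_r r_uniq] pos.
have upd (y : I -> C) t (p' : I -> C) :
    \sum_(j <- r) (if j == k then t else y j) * p' j = \sum_(j <- r) y j * p' j.
  rewrite !big_seq; apply: eq_bigr => j j_r.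
  by case: eqP j_r k_r => // -> ->.
have pos_k y t : (forall j, y j \is Num.real) -> t \is Num.real ->
    0 <= (a + t * p k + \sum_(j <- r) y j * p j)
         * (b + t * q k + \sum_(j <- r) y j * q j).
  move=> y_real t_real.
  have := pos (fun j => if j == k then t else y j).
  rewrite !big_cons eqxx !upd !addrA; apply=> j.
  by case: ifP.
rewrite !big_cons !addrA IHr // => [|y y_real]; last exact: pos_k.
rewrite balance_affine // => t t_real.
have := pos_k (fun=> 0) t (fun=> rpred0 _) t_real.
by rewrite !big1 ?addr0 // => j _; rewrite mul0r.
Qed.
End Balance.

(** * Determinants under diagonal perturbation and Schur complement *)

Section DetUpdate.
Variable R : comNzRingType.

Lemma det_add_delta n (A : 'M[R]_n.+1) k s :
  \det (A + s *: delta_mx k k) = \det A + s * \det (row' k (col' k A)).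
Proof.
have cof j : cofactor (A + s *: delta_mx k k) k j = cofactor A k j.
  rewrite /cofactor; congr (_ * \det _); apply/matrixP=> a b.
  by rewrite !mxE eq_sym (negPf (neq_lift _ _)) mulr0 addr0.
rewrite !(expand_det_row _ k).
under eq_bigr do rewrite cof 2!mxE mulrDl.
rewrite big_split /=; congr (_ + _).
rewrite (bigD1 k) //= big1 => [|j /negPf j_k].
  by rewrite mxE !eqxx addr0 mulr1 /cofactor addnn -signr_odd odd_double mul1r.
by rewrite mxE eqxx j_k mulr0 mul0r.
Qed.

Definition char_det n (L : 'M[R]_n) (x : 'rV[R]_n) := \det (diag_mx x + L).

Definition insert_row n (k : 'I_n.+1) (s : R) (x : 'rV[R]_n) : 'rV[R]_n.+1 :=
  \row_i oapp (x 0) s (unlift k i).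

Lemma insert_row_delta n (k : 'I_n.+1) s (x : 'rV[R]_n) i :
  insert_row k s (x + delta_mx 0 i)
  = insert_row k s x + delta_mx 0 (lift k i).
Proof.
apply/rowP=> j; rewrite !mxE !eqxx /=; case: (unliftP k j) => [j'|] -> /=.
  by rewrite !mxE eqxx (inj_eq lift_inj).
by rewrite (negPf (neq_lift _ _)) addr0.
Qed.

Lemma insert_row_split n (k : 'I_n.+1) (x : 'rV[R]_n.+1) :
  x = insert_row k (x 0 k) (col' k x).
Proof.
apply/rowP=> j; rewrite mxE.
by case: (unliftP k j) => [j'|] -> //=; rewrite mxE.
Qed.

Lemma char_det_insert n (L : 'M[R]_n.+1) k s x :
  char_det L (insert_row k s x)
  = char_det L (insert_row k 0 x) + s * char_det (row' k (col' k L)) x.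
Proof.
rewrite /char_det.
have -> : diag_mx (insert_row k s x) + L
    = (diag_mx (insert_row k 0 x) + L) + s *: delta_mx k k.
  apply/matrixP=> i j; rewrite !mxE.
  case: (unliftP k i) => [i'|] -> /=.
    by rewrite [_ == k]eq_sym (negPf (neq_lift _ _)) mulr0 addr0.
  by rewrite eqxx mul0rn add0r mulr_natr addrC (eq_sym k).
rewrite det_add_delta; congr (_ + _ * \det _).
by apply/matrixP=> i j; rewrite !mxE liftK (inj_eq lift_inj).
Qed.

Lemma char_det_delta n (L : 'M[R]_n) x i s :
  char_det L (x + s *: delta_mx 0 i)
  = char_det L x + s * (char_det L (x + delta_mx 0 i) - char_det L x).
Proof.
case: n L x i => [|n] L x i; first by case: i.
have moved t : x + t *: delta_mx 0 i = insert_row i (x 0 i + t) (col' i x).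
  apply/rowP=> j; rewrite !mxE eqxx /=; case: (unliftP i j) => [j'|] -> /=.
    by rewrite mxE [_ == i]eq_sym (negPf (neq_lift _ _)) mulr0 addr0.
  by rewrite eqxx mulr1.
have at_x : char_det L x = char_det L (insert_row i (x 0 i + 0) (col' i x)).
  by rewrite -moved scale0r addr0.
rewrite -[X in char_det L (x + X) - _]scale1r at_x !moved.
rewrite !(char_det_insert L i (_ + _)); ring.
Qed.

End DetUpdate.

Section Schur.
Variable F : fieldType.

Definition schur_update n (L : 'M[F]_n.+1) (t : F) : 'M[F]_n :=
  \matrix_(i, j) (L (lift ord0 i) (lift ord0 j)
                  + t * (L (lift ord0 i) ord0 * L ord0 (lift ord0 j))).

(** Block LU factorization: the Schur complement of the top left entry p is
    A' - p^-1 u v, a rank one correction of the submatrix A'. *)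
Lemma det_schur n (A : 'M[F]_n.+1) :
    A ord0 ord0 != 0 ->
  \det A = A ord0 ord0 * \det (schur_update A (- (A ord0 ord0)^-1)).
Proof.
move=> a_neq0; set a := A ord0 ord0.
pose u := @dlsubmx _ 1 n 1 n A; pose v := @ursubmx _ 1 n 1 n A.
have factor : A = block_mx 1%:M 0 (a^-1 *: u) 1%:M
    *m block_mx a%:M v 0 (schur_update A (- a^-1)) :> 'M_(1 + n).
  rewrite mulmx_block !mul1mx !mul0mx !addr0 mul_mx_scalar scalerA.
  rewrite mulfV // scale1r -[LHS](@submxK _ 1 n 1 n) -/u -/v; congr block_mx.
    by apply/matrixP=> i j; rewrite !ord1 !mxE !lshift0.
  apply/matrixP=> i j; rewrite !mxE !rshift1 big_ord1 !mxE !rshift1 !lshift0.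
  by rewrite -mulrA mulNr addrC subrK.
rewrite [in LHS]factor det_mulmx (@det_lblock _ 1 n) (@det_ublock _ 1 n).
by rewrite !det1 !mul1r det_scalar1.
Qed.

Lemma char_det_schur n (L : 'M[F]_n.+1) s x :
    s + L ord0 ord0 != 0 ->
  char_det L (insert_row ord0 s x)
  = (s + L ord0 ord0)
    * char_det (schur_update L (- (s + L ord0 ord0)^-1)) x.
Proof.
move=> pivot_neq0; rewrite /char_det det_schur !mxE unlift_none /= mulr1n //.
congr (_ * \det _); apply/matrixP=> i j.
rewrite !mxE liftK /= (inj_eq lift_inj) -!addrA; congr (_ + (_ + _)).
by rewrite !mulr0n !add0r.
Qed.

End Schur.

(** * Matrices with nonnegative Rayleigh differences *)

Section Rayleigh.
Variable C : numClosedFieldType.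

Local Notation real_row x := (x \is a mxOver Num.real).

(** For a multiaffine F the second expression is the Rayleigh difference
    (d_i F) (d_j F) - F (d_i d_j F) at x, written with values of F only. *)
Definition rayleigh n (L : 'M[C]_n) :=
  (forall x, real_row x -> char_det L x \is Num.real) /\
  (forall x i j, real_row x -> i != j ->
    0 <= char_det L (x + delta_mx 0 i) * char_det L (x + delta_mx 0 j)
         - char_det L x * char_det L (x + delta_mx 0 i + delta_mx 0 j)).

Lemma real_insert_row n (k : 'I_n.+1) s (x : 'rV[C]_n) :
  s \is Num.real -> real_row x -> real_row (insert_row k s x).
Proof.
move=> s_real /mxOverP x_real; apply/mxOverP=> a i; rewrite mxE.
by case: (unlift k i) => /=.
Qed.

Lemma real_row0 n : real_row (0 : 'rV[C]_n).
Proof. by apply/mxOverP=> a i; rewrite mxE rpred0. Qed.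

(** The characteristic determinant of the minor is the coefficient of x_k in
    that of L, so its Rayleigh difference is the leading coefficient of a
    quadratic in x_k that is nonnegative on the reals. *)
Lemma rayleigh_minor n (L : 'M[C]_n.+1) k :
  rayleigh L -> rayleigh (row' k (col' k L)).
Proof.
move=> [det_real det_ray]; split=> [x x_real | x i j x_real i_j].
  have -> : char_det (row' k (col' k L)) x
      = char_det L (insert_row k 1 x) - char_det L (insert_row k 0 x).
    by rewrite (char_det_insert L k 1) mul1r addrC addKr.
  by rewrite rpredB // det_real // real_insert_row ?rpred0 ?rpred1.
pose G := char_det (row' k (col' k L)); rewrite -/G.
pose H y := char_det L (insert_row k 0 y).
pose xi := x + delta_mx 0 i; pose xj := x + delta_mx 0 j.
pose xij := x + delta_mx 0 i + delta_mx 0 j; rewrite -/xi -/xj -/xij.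
have [] // := @real_quadratic_ge0 C (H xi * H xj - H x * H xij)
  (H xi * G xj + G xi * H xj - H x * G xij - G x * H xij)
  (G xi * G xj - G x * G xij).
move=> s s_real.
have := det_ray (insert_row k s x) (lift k i) (lift k j).
rewrite -!insert_row_delta -/xi -/xj -/xij !(char_det_insert L k s) -/G -!/(H _).
rewrite (inj_eq lift_inj) real_insert_row // => /(_ isT i_j).
move: (H x) (H xi) (H xj) (H xij) (G x) (G xi) (G xj) (G xij).
move=> h hi hj hij c ci cj cij.
by congr (0 <= _); ring.
Qed.

Lemma rayleigh_diag n (L : 'M[C]_n) i : rayleigh L -> L i i \is Num.real.
Proof.
case: n L i => [|n] L i; first by case: i.
elim: n L i => [|n IHn] L i ray_L.
  have := ray_L.1 0 (real_row0 _); rewrite /char_det det_mx11 !mxE mul0rn add0r.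
  by rewrite (ord1 i).
have [k k_i] : exists k, k != i.
  by exists (lift i ord0); rewrite eq_sym neq_lift.
have := rayleigh_minor k ray_L.
case: (unliftP k i) k_i => [i'|] ->; last by rewrite eqxx.
by move=> _ /(IHn _ i'); rewrite !mxE.
Qed.

Lemma char_det2 (L : 'M[C]_2) x :
  char_det L x = (x 0 0 + L 0 0) * (x 0 1 + L 1 1) - L 0 1 * L 1 0.
Proof.
rewrite /char_det (expand_det_row _ 0) !big_ord_recl big_ord0 addr0.
rewrite /cofactor !det_mx11 !mxE /=.
have -> : lift 0 0 = 1 :> 'I_2 by exact: val_inj.
have -> : lift 1 0 = 0 :> 'I_2 by exact: val_inj.
rewrite !mulr0n !mulr1n /bump /= expr0 expr1; ring.
Qed.

(** Diagonal entries are real. For i != j, deleting all other indices reduces to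
    size 2, where the Rayleigh difference is constant, equal to L_01 L_10. *)
Lemma rayleigh_entry n (L : 'M[C]_n) i j : rayleigh L -> 0 <= L i j * L j i.
Proof.
move=> ray_L; have [->|i_j] := eqVneq i j.
  by rewrite -expr2 -realEsqr; exact: rayleigh_diag.
case: n L i j ray_L i_j => [|n] L i j; first by case: i.
elim: n L i j => [|n IHn] L i j ray_L; first by rewrite !ord1.
move=> i_j.
have [/existsP[k /andP[k_i k_j]]|] := boolP [exists k, (k != i) && (k != j)].
  have := rayleigh_minor k ray_L.
  case: (unliftP k i) k_i i_j => [i'|] ->; last by rewrite eqxx.
  case: (unliftP k j) k_j => [j'|] ->; last by rewrite eqxx.
  rewrite (inj_eq lift_inj) => _ _ i_j /(IHn _ i' j').
  by rewrite !mxE; apply.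
rewrite negb_exists => /forallP only_ij.
have : (#|[set: 'I_n.+2]| <= #|[set i; j]|)%N.
  apply/subset_leq_card/subsetP=> k _; have := only_ij k.
  by rewrite negb_and !negbK !inE.
rewrite cardsT card_ord cards2 i_j !ltnS leqn0 => /eqP n0.
subst n; have := ray_L.2 0 0 1 (real_row0 _) isT.
rewrite !char_det2 !mxE !eqxx /=.
have -> : L i j * L j i = L 0 1 * L 1 0.
  clear only_ij; case: i j i_j => [[|[|//]] lti] [[|[|//]] ltj] //= _.
    by congr (L _ _ * L _ _); exact: val_inj.
  by rewrite mulrC; congr (L _ _ * L _ _); exact: val_inj.
by congr (0 <= _); ring.
Qed.

Definition balance_mx n (L : 'M[C]_n) : 'M[C]_n :=
  \matrix_(i, j) balance (L i j) (L j i).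

(** For x_0 = - t^-1 - L_00 the pivot of diag(x) + L is - t^-1 and the Schur
    complement is the given update; its characteristic determinant is then a
    specialization of that of L, up to a real factor. *)
Lemma rayleigh_schur n (L : 'M[C]_n.+1) t :
  rayleigh L -> t \is Num.real -> t != 0 -> rayleigh (schur_update L t).
Proof.
move=> ray_L t_real t_neq0; have [det_real det_ray] := ray_L.
pose r := - t^-1; pose s := r - L ord0 ord0.
have r_real : r \is Num.real by rewrite rpredN rpredV.
have s_real : s \is Num.real by rewrite rpredB // rayleigh_diag.
have r_neq0 : r != 0 by rewrite oppr_eq0 invr_eq0.
have sr : s + L ord0 ord0 = r by rewrite subrK.
have schurE x : char_det (schur_update L t) x
    = r^-1 * char_det L (insert_row ord0 s x).
  rewrite char_det_schur sr // mulKf //.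
  by rewrite /r invrN invrK opprK.
split=> [x x_real | x i j x_real i_j].
  by rewrite schurE rpredM ?rpredV // det_real // real_insert_row.
rewrite !schurE !insert_row_delta.
have := det_ray (insert_row ord0 s x) (lift ord0 i) (lift ord0 j).
rewrite real_insert_row // (inj_eq lift_inj) => /(_ isT i_j) ray_ge0.
rewrite mulrACA [X in _ - X]mulrACA -mulrBr mulr_ge0 // -expr2 -realEsqr.
by rewrite rpredV.
Qed.

(** Induction through the Schur complement of the first pivot, which disposes
    of every x_0 except - L_00; that value is recovered because both sides are
    affine in x_0. *)
Lemma rayleigh_balance n (L : 'M[C]_n) x :
  rayleigh L -> real_row x -> char_det (balance_mx L) x = char_det L x.
Proof.
elim: n L x => [|n IHn] L x ray_L x_real; first by rewrite /char_det !det_mx00.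
set B := balance_mx L.
have B00 : B ord0 ord0 = L ord0 ord0 by rewrite mxE balance_id.
have prod_ge0 i j t : t \is Num.real ->
    0 <= schur_update L t i j * schur_update L t j i.
  move=> t_real; have [->|t_neq0] := eqVneq t 0.
    by rewrite !mxE !mul0r !addr0 rayleigh_entry.
  exact/rayleigh_entry/rayleigh_schur.
have schur_balance t : t \is Num.real ->
    schur_update B t = balance_mx (schur_update L t).
  move=> t_real; apply/matrixP=> i j.
  rewrite [RHS]mxE ![schur_update L t _ _]mxE [L (lift ord0 j) _ * _]mulrC.
  rewrite balance_affine //.
    by rewrite !mxE -balanceM.
  move=> u u_real; have := prod_ge0 i j u u_real.
  by rewrite !mxE [L (lift ord0 j) ord0 * _]mulrC.
have agree s y : s \is Num.real -> real_row y -> s + L ord0 ord0 != 0 ->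
    char_det B (insert_row ord0 s y) = char_det L (insert_row ord0 s y).
  move=> s_real y_real pivot_neq0.
  have pivot_real : s + L ord0 ord0 \is Num.real.
    by rewrite rpredD // rayleigh_diag.
  rewrite !char_det_schur ?B00 // schur_balance ?rpredN ?rpredV //.
  rewrite IHn //; apply: rayleigh_schur; rewrite ?rpredN ?rpredV //.
  by rewrite oppr_eq0 invr_eq0.
rewrite (insert_row_split ord0 x).
have : real_row (col' ord0 x).
  by apply/mxOverP=> a b; rewrite mxE; move/mxOverP: x_real; apply.
have : x 0 ord0 \is Num.real by move/mxOverP: x_real; apply.
move: (x 0 _) (col' _ _) => {x x_real} s y s_real y_real.
have L00_real := rayleigh_diag ord0 ray_L.
(* Two values of s with nonzero pivot determine an affine function. *)
have := agree (1 - L ord0 ord0) y; have := agree (2 - L ord0 ord0) y.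
rewrite !subrK !rpredB ?rpred1 ?realn // oner_eq0 pnatr_eq0.
move=> /(_ isT y_real isT) + /(_ isT y_real isT).
rewrite !(char_det_insert _ _ (_ - _)) !(char_det_insert _ _ s).
set b0 := char_det B _; set l0 := char_det L _.
set b1 := char_det _ y; set l1 := char_det _ y => eq2 eq1.
have b1l1 : b1 = l1.
  have -> : b1 = (b0 + (2 - L ord0 ord0) * b1) - (b0 + (1 - L ord0 ord0) * b1).
    by ring.
  by rewrite eq2 eq1; ring.
by move: eq1; rewrite b1l1 => /addIr ->.
Qed.
End Rayleigh.

(** * Vanishing of polynomials at natural points *)

Lemma digits_inj n N (d e : 'I_n -> nat) :
    (forall i, d i < N)%N -> (forall i, e i < N)%N ->
    (\sum_(i < n) d i * N ^ i = \sum_(i < n) e i * N ^ i)%N -> d =1 e.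
Proof.
elim: n d e => [|n IHn] d e d_lt e_lt; first by move=> _ [].
have split_sum (c : 'I_n.+1 -> nat) : (\sum_(i < n.+1) c i * N ^ i
    = (\sum_(i < n) c (lift ord0 i) * N ^ i) * N + c ord0)%N.
  rewrite big_ord_recl expn0 muln1 addnC big_distrl /=; congr (_ + _)%N.
  by apply: eq_bigr => i _; rewrite -mulnA -expnSr.
rewrite !split_sum => eq_sum.
have eq0 : d ord0 = e ord0.
  by have := congr1 (modn^~ N) eq_sum; rewrite /= !modnMDl !modn_small.
have N_gt0 : (0 < N)%N by apply: leq_ltn_trans (d_lt ord0).
move/eqP: eq_sum; rewrite eq0 eqn_add2r eqn_pmul2r // => /eqP eq_tl.
move=> i; case: (unliftP ord0 i) => [j|] -> //.
exact: (IHn (fun j => d (lift ord0 j)) (fun j => e (lift ord0 j))).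
Qed.

Lemma horner_nat_eq0 (F : numDomainType) (q : {poly F}) :
  (forall k : nat, q.[k%:R] = 0) -> q = 0.
Proof.
move=> q_nat; apply/eqP/negPn/negP => q_neq0.
pose nats : seq F := [seq k%:R | k <- iota 0 (size q)].
suff : (size nats < size q)%N by rewrite size_map size_iota ltnn.
apply: max_poly_roots => //.
  by apply/allP=> _ /mapP[k _ ->]; rewrite rootE q_nat.
by rewrite map_inj_uniq ?iota_uniq //; exact: mulrIn (oner_neq0 _).
Qed.

(** Kronecker substitution: for N larger than all exponents, sending the i-th
    variable to X^(N^i) maps distinct monomials to distinct powers of X. *)
Lemma mpoly_nat_eq0 (F : numDomainType) m (p : {mpoly F[m]}) :
  (forall v : 'I_m -> nat, p.@[fun i => (v i)%:R] = 0) -> p = 0.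
Proof.
move=> p_nat; pose N := msize p.
pose code (a : 'X_{1..m}) := (\sum_(i < m) a i * N ^ i)%N.
pose q : {poly F} := \sum_(a <- msupp p) p@_a *: 'X^(code a).
have q0 : q = 0.
  apply: horner_nat_eq0 => k; rewrite -(p_nat (fun i => k ^ (N ^ i))%N).
  rewrite horner_sum mevalE; apply: eq_bigr => a _.
  rewrite hornerZ hornerXn; congr (_ * _); rewrite expr_sum.
  by apply: eq_bigr => i _; rewrite natrX -exprM mulnC.
have digit_lt a i : a \in msupp p -> (a i < N)%N.
  move/msize_mdeg_lt; apply: leq_ltn_trans.
  by rewrite mdegE (bigD1 i) //= leq_addr.
apply/mpolyP=> a; rewrite mcoeff0.
have [a_p|] := boolP (a \in msupp p); last by move/memN_msupp_eq0.
have := congr1 (fun r : {poly F} => r`_(code a)) q0; rewrite coef0 coef_sum.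
rewrite (bigD1_seq a) ?msupp_uniq //= coefZ coefXn eqxx mulr1 big_seq_cond.
rewrite big1 ?addr0 // => b /andP[b_p b_a]; rewrite coefZ coefXn.
case: eqP => [code_eq|]; last by rewrite mulr0.
case/eqP: b_a; apply/mnmP=> i.
by symmetry; apply: (@digits_inj m N a b) => // j; exact: digit_lt.
Qed.

(** * Rayleigh differences of stable polynomials *)

Section Stable.
Variable R : realType.
Local Notation C := R[i].
Local Open Scope complex_scope.

(** On real arguments the imaginary part of a complex polynomial is a real
    polynomial; this gives access to its continuity. *)
Lemma Im_horner (Q : {poly C}) :
  exists P : {poly R}, forall e : R, P.[e] = complex.Im Q.[e%:C].
Proof.
elim/poly_ind: Q => [|Q c [P PQ]].
  by exists 0 => e; rewrite !horner0.
exists (P * 'X + (complex.Im c)%:P) => e.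
rewrite !hornerMXaddC PQ; case: (Q.[_]) => a b; case: c => c d /=.
by rewrite mulr0 add0r.
Qed.

Lemma Im_horner_ge0 (Q : {poly C}) :
    (forall e : R, 0 < e -> 0 <= complex.Im Q.[e%:C]) ->
  0 <= complex.Im Q.[0].
Proof.
have [P PQ] := Im_horner Q; move=> pos.
rewrite -(rmorph0 (real_complex R)) -PQ leNgt; apply/negP=> P0_lt0.
have [] := @poly_cont R 0 P (- P.[0]); first by rewrite oppr_gt0.
move=> d d_gt0 /(_ (d / 2)).
rewrite subr0 gtr0_norm ?divr_gt0 // ltr_pdivrMr // ltr_pMr // ltr1n.
move=> /(_ isT).
rewrite ltNge => /negP; apply.
have := pos (d / 2); rewrite divr_gt0 // -PQ => /(_ isT) ge0.
by apply: le_trans (ler_norm _); rewrite -subr_ge0 opprK addrNK.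
Qed.

Lemma horner_mmap m (p : {mpoly C[m]}) (h : 'I_m -> {poly C}) (e : C) :
  (mmap polyC h p).[e] = p.@[fun j => (h j).[e]].
Proof.
rewrite mevalE /mmap horner_sum; apply: eq_bigr => a _.
rewrite hornerM hornerC; congr (_ * _).
rewrite /mmap1 horner_prod; apply: eq_bigr => i _; exact: horner_exp.
Qed.

Definition shift m (k : 'I_m) (s : C) (z : 'I_m -> C) : 'I_m -> C :=
  fun j => z j + s *+ (j == k).

Lemma complexify_real m (f : {mpoly R[m]}) (z : 'I_m -> C) :
  (forall j, z j \is Num.real) -> (complexify f).@[z] \is Num.real.
Proof.
move=> z_real; rewrite mevalE rpred_sum // => a _.
rewrite rpredM ?rpred_prod // => [|j _]; last exact: rpredX.
by rewrite /complexify mcoeff_map_mpoly; apply/complex_realP; exists (f@_a).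
Qed.

(** Write f(z + s e_k + t e_l) = N(s) + t D(s) and take s = i. Whenever
    Im (N D^* ) < 0, the root t = - N / D lies in the upper half plane. At the
    real point z the number Im (N D^* ) is the Rayleigh difference, but there
    the remaining variables are real, so stability does not apply. Moving these
    by i e with e > 0 gives Im (N D^* ) >= 0, and e tends to 0. *)
Lemma stable_rayleigh m (f : {mpoly R[m]}) (k l : 'I_m) (z : 'I_m -> C) :
    stable f ->
    k != l ->
    (forall j s y, j \in [:: k; l] ->
      (complexify f).@[shift j s y] = (complexify f).@[y]
        + s * ((complexify f).@[shift j 1 y] - (complexify f).@[y])) ->
    (forall j, z j \is Num.real) ->
  0 <= (complexify f).@[shift k 1 z] * (complexify f).@[shift l 1 z]
       - (complexify f).@[z] * (complexify f).@[shift k 1 (shift l 1 z)].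
Proof.
move=> f_stable k_l affine z_real; set g := fun y => (complexify f).@[y].
(* The coordinates other than k and l are pushed into the upper half plane,
   where stability applies. *)
pose w (e : C) j := if (j == k) || (j == l) then z j else z j + 'i * e.
have bilin y s t : g (shift k s (shift l t y))
    = g y + s * (g (shift k 1 y) - g y) + t * (g (shift l 1 y) - g y)
      + s * t * (g (shift k 1 (shift l 1 y)) - g (shift k 1 y)
                 - g (shift l 1 y) + g y).
  have comm u v : g (shift k u (shift l v y)) = g (shift l v (shift k u y)).
    by apply: meval_eq => j; rewrite /shift addrAC.
  rewrite /g (affine k) ?mem_head // -!/(g _) (comm 1) /g.
  rewrite !(affine l t) ?inE ?eqxx ?orbT // -!/(g _) (comm 1).
  move: (g y) (g (shift k 1 y)) (g (shift l 1 y)) => *.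
  move: (g (shift l 1 (shift k 1 y))) => *; ring.
(* The values at z + a e_k + b e_l, as polynomials in the perturbation. *)
pose h (a b : C) : {poly C} := mmap polyC
  (fun j => (shift k a (shift l b z) j)%:P
            + (if (j == k) || (j == l) then 0 else 'i%:P * 'X)) (complexify f).
have hE a b e : (h a b).[e] = g (shift k a (shift l b (w e))).
  rewrite horner_mmap; apply: meval_eq => j; rewrite hornerD hornerC /shift /w.
  case: ifP => _; rewrite ?hornerCM ?hornerX ?horner0 ?addr0 //.
  by rewrite addrAC [_ + 'i * e]addrAC.
have num_den e t : g (shift k 'i (shift l t (w e)))
    = (h 'i 0).[e] + t * (h 'i 1 - h 'i 0).[e].
  rewrite hornerD hornerN !hE !(bilin _ 'i).
  move: (g (w e)) (g (shift k 1 (w e))) (g (shift l 1 (w e))) => *.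
  move: (g (shift k 1 (shift l 1 (w e)))) => *; ring.
pose Q := h 'i 0 * map_poly conjc (h 'i 1 - h 'i 0).
have QE (e : R) :
    Q.[e%:C] = (h 'i 0).[e%:C] * ((h 'i 1 - h 'i 0).[e%:C])^*%C.
  by rewrite hornerM -[in X in _ * X](conjc_real e) horner_map.
have w0 : w 0%:C =1 z by move=> j; rewrite /w mulr0 addr0 if_same.
have Q0_ge0 : 0 <= complex.Im Q.[0].
  apply: Im_horner_ge0 => e e_gt0; rewrite QE leNgt; apply/negP.
  set N := (h 'i 0).[_]; set D := (h 'i 1 - _).[_] => ND_lt0.
  have D_neq0 : D != 0.
    by apply: contraTneq ND_lt0 => ->; rewrite conjc0 mulr0 ltxx.
  have := num_den e%:C (- N / D); rewrite -/N -/D divfK // subrr => /eqP.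
  apply/negP/f_stable => j; rewrite /shift /w.
  have /complex_realP[zj ->] := z_real j.
  have [->|j_k] := eqVneq j k.
    by rewrite (negPf k_l) mulr0n mulr1n addr0 /= add0r ltr01.
  have [_|j_l] := eqVneq j l; last first.
    by rewrite !mulr0n !addr0 /= !(mul0r, mul1r, add0r).
  rewrite mulr0n mulr1n addr0.
  move: D_neq0 ND_lt0; case: (D) => c d; case: (N) => a b /=; simpc.
  rewrite eq_complex /= negb_and => cd_neq0 ND_lt0.
  rewrite !mulrA -mulrBl divr_gt0 //.
    by rewrite subr_gt0 -subr_lt0 addrC.
  rewrite lt_def addr_ge0 ?sqr_ge0 // paddr_eq0 ?sqr_ge0 //.
  by rewrite !sqrf_eq0 negb_and cd_neq0.
rewrite -(rmorph0 (real_complex R)) QE hornerD hornerN !hE in Q0_ge0.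
(* At e = 0 everything is real, and the inequality is the one sought. *)
have gw0 : (g (w 0%:C) = g z) * (g (shift k 1 (w 0%:C)) = g (shift k 1 z))
    * (g (shift l 1 (w 0%:C)) = g (shift l 1 z))
    * (g (shift k 1 (shift l 1 (w 0%:C))) = g (shift k 1 (shift l 1 z))).
  by do !split; apply: meval_eq => j; rewrite /shift w0.
rewrite !(bilin _ 'i) !gw0 -/(g z) -!/(g (shift _ _ _)) in Q0_ge0 *.
have shift_real j s y : s \is Num.real -> (forall a, y a \is Num.real) ->
    (forall a, shift j s y a \is Num.real).
  by move=> s_real y_real a; rewrite rpredD ?rpredMn.
have real_g y : (forall a, y a \is Num.real) -> exists r, g y = r%:C.
  by move=> y_real; apply/complex_realP/complexify_real.
have [|r00 e00] := real_g z; first by [].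
have [|r10 e10] := real_g (shift k 1 z); first exact/shift_real.
have [|r01 e01] := real_g (shift l 1 z); first exact/shift_real.
have [|r11 e11] := real_g (shift k 1 (shift l 1 z)).
  by do 2![apply/shift_real => //].
rewrite e00 e10 e01 e11 in Q0_ge0 *.
rewrite -!rmorphM -rmorphB ler0c.
move: Q0_ge0; congr (0 <= _); rewrite /=; simpc; ring.
Qed.

End Stable.

(** * Determinantal pencils *)

Section Pencil.
Variables (R : realType) (n m : nat) (le_nm : (n <= m)%N).
Local Notation C := R[i].
Implicit Types (K : 'M[C]_n) (A : 'I_m -> 'M[C]_n) (z : 'I_m -> C).

Definition pencil_const K A z : 'M[C]_n :=
  K + \sum_(j < m | (n <= j)%N) z j *: A j.

Definition diag_row z : 'rV[C]_n := \row_k z (widen_ord le_nm k).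

Lemma pencil_eval K A z :
  (\det (pencil le_nm K A)).@[z] = char_det (pencil_const K A z) (diag_row z).
Proof.
rewrite -det_map_mx /char_det; congr (\det _); apply/matrixP=> i j.
rewrite !mxE !summxE /= !mevalD mevalC -addrA; congr (_ + _).
  by rewrite mevalMn mevalXU.
rewrite addrC raddf_sum; congr (_ + _); apply: eq_bigr => k _.
by rewrite !mxE /= mevalM mevalXU mevalC.
Qed.

Lemma pencil_const_shift K A z i s :
  pencil_const K A (shift (widen_ord le_nm i) s z) = pencil_const K A z.
Proof.
congr (_ + _); apply: eq_bigr => j n_j; rewrite /shift.
case: eqP => [j_i|_]; last by rewrite mulr0n addr0.
by move: n_j; rewrite j_i /= leqNgt ltn_ord.
Qed.

Lemma diag_row_shift z i s :
  diag_row (shift (widen_ord le_nm i) s z) = diag_row z + s *: delta_mx 0 i.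
Proof.
apply/rowP=> j; rewrite !mxE eqxx /= /shift mulr_natr.
by congr (_ + _ *+ _).
Qed.

Definition glue (x : 'rV[C]_n) z : 'I_m -> C :=
  fun j => oapp (x 0) (z j) (insub (val j)).

Lemma diag_row_glue x z : diag_row (glue x z) = x.
Proof. by apply/rowP=> k; rewrite !mxE /glue /= valK. Qed.

Lemma pencil_const_glue K A x z :
  pencil_const K A (glue x z) = pencil_const K A z.
Proof.
congr (_ + _); apply: eq_bigr => j n_j.
by rewrite /glue insubF // ltnNge n_j.
Qed.

Lemma rayleigh_pencil (f : {mpoly R[m]}) K A z :
    stable f -> complexify f = \det (pencil le_nm K A) ->
    (forall j, z j \is Num.real) ->
  rayleigh (pencil_const K A z).
Proof.
move=> f_stable f_det z_real.
have detE y : (complexify f).@[y] = char_det (pencil_const K A y) (diag_row y).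
  by rewrite f_det pencil_eval.
have glueE x : char_det (pencil_const K A z) x = (complexify f).@[glue x z].
  by rewrite detE diag_row_glue pencil_const_glue.
have glue_real x : x \is a mxOver Num.real -> forall j, glue x z j \is Num.real.
  move=> /mxOverP x_real j; rewrite /glue; case: insub => //=.
split=> [x x_real | x i j x_real i_j].
  by rewrite glueE complexify_real //; exact: glue_real.
have := @stable_rayleigh R m f (widen_ord le_nm i) (widen_ord le_nm j)
  (glue x z) f_stable.
rewrite !detE !pencil_const_shift !diag_row_shift !pencil_const_glue.
rewrite !diag_row_glue !scale1r addrAC; apply.
- by apply: contra i_j => /eqP/(congr1 val)/= /val_inj ->.
- move=> k s y; rewrite !inE => /orP[] /eqP ->;
  by rewrite !detE !pencil_const_shift !diag_row_shift scale1r char_det_delta.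
- exact: glue_real.
Qed.

Lemma pencil_const_balance K A z :
    (forall y, (forall j, y j \is Num.real) -> forall i j,
      0 <= pencil_const K A y i j * pencil_const K A y j i) ->
    (forall j, z j \is Num.real) ->
  pencil_const (balance_mx K) (fun j => balance_mx (A j)) z
  = balance_mx (pencil_const K A z).
Proof.
move=> pos z_real; apply/matrixP=> i j.
have entry L B y a b : pencil_const L B y a b
    = L a b + \sum_(k <- [seq k : 'I_m <- index_enum 'I_m | (n <= k)%N])
                y k * B k a b.
  rewrite !mxE summxE big_filter; congr (_ + _).
  by apply: eq_bigr => k _; rewrite mxE.
rewrite entry [RHS]mxE !entry balance_sum ?filter_uniq ?index_enum_uniq //.
  by rewrite mxE; congr (_ + _); apply: eq_bigr => k _; rewrite mxE.
by move=> y y_real; rewrite -!entry pos.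
Qed.

Lemma balance_mx_herm (L : 'M[C]_n) :
  (forall i j, 0 <= L i j * L j i) -> balance_mx L \is hermsymmx.
Proof.
move=> pos; apply/is_hermitianmxP; rewrite expr0 scale1r.
by apply/matrixP=> i j; rewrite !mxE balance_conj.
Qed.

(** Along the line through 0 in direction e_k, the products of opposite entries
    are quadratics whose extreme coefficients are the products for K and
    A_k. *)
Lemma pencil_coef_ge0 K A :
    (forall y, (forall j, y j \is Num.real) -> forall i j,
      0 <= pencil_const K A y i j * pencil_const K A y j i) ->
  (forall i j, 0 <= K i j * K j i) /\
  (forall k : 'I_m, (n <= k)%N -> forall i j, 0 <= A k i j * A k j i).
Proof.
move=> pos.
have line (k : 'I_m) i j : (n <= k)%N ->
  0 <= K i j * K j i /\ 0 <= A k i j * A k j i.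
  move=> n_k; have [] // := @real_quadratic_ge0 C (K i j * K j i)
    (K i j * A k j i + A k i j * K j i) (A k i j * A k j i).
  move=> t t_real; have := pos (fun a => t *+ (a == k)) _ i j.
  have entry a b : pencil_const K A (fun a => t *+ (a == k)) a b
      = K a b + t * A k a b.
    rewrite mxE (bigD1 k) //= big1 => [|l /andP[_ /negPf ->]].
      by rewrite eqxx addr0 mxE.
    by rewrite mulr0n scale0r.
  rewrite !entry => /(_ (fun=> rpredMn _ t_real)).
  by congr (0 <= _); ring.
split=> [i j|k n_k i j]; last by case: (line k i j n_k).
have := pos (fun=> 0) (fun=> rpred0 _) i j.
by rewrite /pencil_const big1 ?addr0 // => k _; rewrite scale0r.
Qed.
End Pencil.

Local Open Scope complex_scope.

Theorem theorem6p4 (R : realType) (n m : nat) (le_nm : (n <= m)%N)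
    (f : {mpoly R[m]}) :
  stable f ->
  complex_determinantal le_nm f ->
  exists (B0 : 'M[R[i]]_n) (B : 'I_m -> 'M[R[i]]_n),
    [/\ B0 \is hermsymmx,
        forall j : 'I_m, (n <= j)%N -> B j \is hermsymmx
      & complexify f = \det (pencil le_nm B0 B)].
Proof.
move=> f_stable [A0 [A f_det]].
have ray := rayleigh_pencil f_stable f_det.
have pos y (y_real : forall j, y j \is Num.real) i j :=
  rayleigh_entry i j (ray y y_real).
have [A0_ge0 A_ge0] := pencil_coef_ge0 pos.
exists (balance_mx A0), (fun j => balance_mx (A j)); split.
- exact: balance_mx_herm.
- by move=> k n_k; apply/balance_mx_herm/A_ge0.
apply/eqP; rewrite -subr_eq0; apply/eqP/mpoly_nat_eq0 => v.
set z := fun i => _; have z_real j : z j \is Num.real by exact: realn.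
have balanced := pencil_const_balance pos z_real.
have diag_real : diag_row le_nm z \is a mxOver Num.real.
  by apply/mxOverP=> a k; rewrite mxE.
have same_det := rayleigh_balance (ray z z_real) diag_real.
rewrite -balanced -!pencil_eval -f_det in same_det.
by apply/eqP; rewrite mevalB subr_eq0 same_det.
Qed.
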